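(* Let $R$ be an integral domain and $M$ a nonzero, non-simple unital $R$-module. Then $M$ is a uniserial module if and only if the divisor topology $D(M)$ is a nested topology.
   Context: For $m,n\in M$ write $m\mid n$ if $n=rm$ for some $r\in R$ (equivalently $Rn\subseteq Rm$). Put $M^{\#}=\{0\neq m\in M: Rm\neq M\}$ and define an equivalence relation on $M^{\#}$ by $m\sim n$ iff $Rm=Rn$; let $[m]$ be the class of $m$ and $\operatorname{EC}(M^{\#})=\{[m]:m\in M^{\#}\}$. For $m\in M^{\#}$ let $U_m=\{[n]\in \operatorname{EC}(M^{\#}): n\mid m\}$. The family $\{U_m\}_{m\in M^{\#}}$ is a basis of a topology on $\operatorname{EC}(M^{\#})$, called the divisor topology of $M$ and denoted $D(M)$ (also denoting the resulting space). An $R$-module is uniserial if any two of its submodules are comparable under inclusion. A topological space is nested if any two of its open sets are comparable under inclusion. *)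

(* Defs.v *)
From HB Require Import structures.
From mathcomp Require Import all_boot all_algebra.
From mathcomp Require Import all_classical topology.
Set Implicit Arguments.
Unset Strict Implicit.
Unset Printing Implicit Defensive.
Import GRing.Theory.
Local Open Scope classical_set_scope.
Local Open Scope ring_scope.
Local Open Scope quotient_scope.

Section Modules.
Context {R : idomainType} (M : lmodType R).

Definition submodule (N : set M) : Prop := submod_closed (mem N).

Definition nonzero_module : Prop := exists m : M, m != 0.

Definition simple_module : Prop :=
  nonzero_module /\
  forall N : set M, submodule N -> N = [set 0] \/ N = [set: M].

Definition uniserial : Prop :=
  forall N P : set M, submodule N -> submodule P -> N `<=` P \/ P `<=` N.

End Modules.

Definition nested (T : topologicalType) : Prop :=
  forall A B : set T, open A -> open B -> A `<=` B \/ B `<=` A.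

Section Divisibility.
Context {R : idomainType} {M : lmodType R}.

Definition cyclic_submodule (m : M) : set M := [set r *: m | r in [set: R]].

Definition module_dvd (m n : M) : Prop := exists r : R, n = r *: m.

End Divisibility.

Section DivisorSpace.
Context {R : idomainType} (M : lmodType R).

(* Used below both as a set and, through set_type, as the type of its
   elements. *)
Definition sharp : set M := [set m | m != 0 /\ cyclic_submodule m <> [set: M]].

Definition sharp_equiv : rel sharp :=
  fun m n => `[< cyclic_submodule (val m) = cyclic_submodule (val n) >].

Lemma sharp_equiv_refl : reflexive sharp_equiv.
Proof. by move=> m; apply/asboolP. Qed.

Lemma sharp_equiv_sym : symmetric sharp_equiv.
Proof. by move=> m n; apply/asboolP/asboolP. Qed.

Lemma sharp_equiv_trans : transitive sharp_equiv.
Proof. by move=> n m p /asboolP mn /asboolP np; apply/asboolP; rewrite mn. Qed.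

Canonical sharp_equiv_rel : equiv_rel sharp :=
  EquivRel sharp_equiv sharp_equiv_refl sharp_equiv_sym sharp_equiv_trans.

Definition divisor_space : Type := {eq_quot sharp_equiv}.

HB.instance Definition _ := Choice.on divisor_space.
HB.instance Definition _ := Quotient.on divisor_space.
HB.instance Definition _ : EqQuotient _ sharp_equiv divisor_space :=
  EqQuotient.on divisor_space.

(* U_m, as a set of classes [n]; by divisor_basicP membership does not depend
   on the chosen representative n. *)
Definition divisor_basic (m : sharp) : set divisor_space :=
  [set \pi_divisor_space n | n in [set n : sharp | module_dvd (val n) (val m)]].

Lemma module_dvd_refl (m : M) : module_dvd m m.
Proof. by exists 1; rewrite scale1r. Qed.

Lemma module_dvd_trans (m n p : M) :
  module_dvd m n -> module_dvd n p -> module_dvd m p.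
Proof. by move=> [r ->] [s ->]; exists (s * r); rewrite scalerA. Qed.

Lemma sharp_equiv_dvd (m n : sharp) :
  sharp_equiv m n -> module_dvd (val m) (val n).
Proof.
move=> /asboolP mn; have : cyclic_submodule (val n) (val n).
  by exists 1; rewrite ?scale1r.
by rewrite -mn => -[r _ <-]; exists r.
Qed.

Lemma divisor_basicP (m n : sharp) :
  divisor_basic m (\pi n) <-> module_dvd (val n) (val m).
Proof.
split=> [[k km /eqmodP kn]|nm]; last by exists n.
apply: module_dvd_trans km; apply: sharp_equiv_dvd.
by rewrite sharp_equiv_sym.
Qed.

Lemma divisor_basic_cover :
  \bigcup_(U in range divisor_basic) id U = [set: divisor_space].
Proof.
apply/seteqP; split=> // x _; rewrite -[x]reprK.
exists (divisor_basic (repr x)); first by exists (repr x).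
exact/divisor_basicP/module_dvd_refl.
Qed.

Lemma divisor_basic_join (U V : set divisor_space) (x : divisor_space) :
  range divisor_basic U -> range divisor_basic V -> id U x -> id V x ->
  exists W, [/\ range divisor_basic W, id W x & id W `<=` id U `&` id V].
Proof.
rewrite -[x]reprK => -[m _ <-] [n _ <-] /divisor_basicP xm /divisor_basicP xn.
exists (divisor_basic (repr x)); split; first by exists (repr x).
  exact/divisor_basicP/module_dvd_refl.
move=> _ [k kx <-]; split; apply/divisor_basicP.
  exact: module_dvd_trans kx xm.
exact: module_dvd_trans kx xn.
Qed.

(* The index type of a base must be pointed, and [sharp] may be empty, so the
   base is the set of all [divisor_basic m], indexed by itself. *)
HB.instance Definition _ := isBaseTopological.Build divisor_space
  divisor_basic_cover divisor_basic_join.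

Lemma divisor_openP (A : set divisor_space) :
  open A <-> exists S : set sharp, A = \bigcup_(m in S) divisor_basic m.
Proof.
split=> [[F FD <-]|[S ->]].
  exists [set m | F (divisor_basic m)]; apply/seteqP; split=> x.
    by move=> [U FU Ux]; have [m _ mU] := FD U FU; exists m; rewrite /= mU.
  by move=> [m Fm mx]; exists (divisor_basic m).
exists (divisor_basic @` S); first by move=> _ [m _ <-]; exists m.
by rewrite bigcup_image.
Qed.

End DivisorSpace.

(* Main.v *)
Require Import Defs.
From mathcomp Require Import all_boot all_algebra.
From mathcomp Require Import all_classical topology.

(* Both conditions say that divisibility is total: on [M] for uniseriality, and
   on [sharp] for nestedness, since [U_m] is the least open set containing
   [[m]].  The elements outside [sharp], namely [0] and the generators of [M],
   are comparable to everything. *)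

Import GRing.Theory.
Local Open Scope classical_set_scope.
Local Open Scope ring_scope.
Local Open Scope quotient_scope.

Section Modules.
Context {R : idomainType} {M : lmodType R}.

Lemma submodule_cyclic (m : M) : submodule (cyclic_submodule m).
Proof.
split=> [|a u v]; first by apply/mem_set; exists 0; rewrite ?scale0r.
move=> /set_mem[r _ <-] /set_mem[s _ <-]; apply/mem_set.
by exists (a * r + s); rewrite ?scalerDl ?scalerA.
Qed.

Lemma submodule_dvd (N : set M) (m n : M) :
  submodule N -> module_dvd m n -> N m -> N n.
Proof.
move=> [N0 NL] [r ->] /mem_set Nm.
by have /set_mem := NL r m 0 Nm N0; rewrite addr0.
Qed.

Lemma cyclic_submoduleP (m n : M) : cyclic_submodule m n <-> module_dvd m n.
Proof. by split=> [[r _ <-]|[r ->]]; exists r. Qed.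

(** Comparing [cyclic_submodule m] with [cyclic_submodule n] gives one direction: the smaller one
    has its generator divisible by the other. Conversely, if [x] lies in [N] but not in [P], no [y]
    in [P] divides [x], so [x] divides every such [y], and [N] absorbs multiples of [x]. *)
Lemma uniserialP :
  uniserial M <-> forall m n : M, module_dvd m n \/ module_dvd n m.
Proof.
split=> [uM m n|dvdM N P subN subP].
  have [mn|nm] := uM _ _ (submodule_cyclic m) (submodule_cyclic n).
    by right; apply/cyclic_submoduleP/mn/cyclic_submoduleP/module_dvd_refl.
  by left; apply/cyclic_submoduleP/nm/cyclic_submoduleP/module_dvd_refl.
apply/or_asboolP; case: asboolP => //= /existsNP[x /not_implyP[Nx NPx]].
apply/asboolP => y Py; have [xy|yx] := dvdM x y.
  exact: submodule_dvd xy Nx.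
by case: NPx; apply: submodule_dvd yx Py.
Qed.

Lemma dvd_total_sharp :
  (forall m n : @sharp R M, module_dvd (val m) (val n) \/ module_dvd (val n) (val m))
  <-> forall m n : M, module_dvd m n \/ module_dvd n m.
Proof.
split=> [dvdM m n|dvdM m n]; last exact: dvdM.
have dvd_nsharp (x y : M) : ~ sharp x -> module_dvd x y \/ module_dvd y x.
  (* Either [x] is [0], a multiple of [y], or [x] generates [M] and hence divides [y]. *)
  move=> /not_andP[/negP/negPn/eqP ->|/contrapT gen_x].
    by right; exists 0; rewrite scale0r.
  by left; apply/cyclic_submoduleP; rewrite gen_x.
have [/mem_set sm|/dvd_nsharp] := pselect (sharp m); last exact.
have [/mem_set sn|/dvd_nsharp nm] := pselect (sharp n).
  exact: (dvdM (SigSub sm) (SigSub sn)).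
by apply/or_comm/nm.
Qed.

Lemma open_divisor_basic (m : @sharp R M) : open (divisor_basic m).
Proof. by apply/divisor_openP; exists [set m]; rewrite bigcup_set1. Qed.

(** Transitivity of divisibility closes each basic set under divisors, and unions inherit this. *)
Lemma open_dvd (A : set (divisor_space M)) (m n : @sharp R M) :
  open A -> module_dvd (val n) (val m) -> A (\pi m) -> A (\pi n).
Proof.
move=> /divisor_openP[S ->] nm [k Sk /divisor_basicP mk]; exists k => //.
by apply/divisor_basicP; apply: module_dvd_trans mk.
Qed.

(** The argument of [uniserialP] with the order reversed: open sets are closed under divisors, as
    submodules are under multiples. *)
Lemma nestedP : nested (divisor_space M) <->
  forall m n : @sharp R M, module_dvd (val m) (val n) \/ module_dvd (val n) (val m).
Proof.
split=> [nM m n|dvdM A B oA oB].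
  have [mn|nm] := nM _ _ (open_divisor_basic m) (open_divisor_basic n).
    by left; apply/divisor_basicP/mn/divisor_basicP/module_dvd_refl.
  by right; apply/divisor_basicP/nm/divisor_basicP/module_dvd_refl.
apply/or_asboolP; case: asboolP => //= /existsNP[x /not_implyP[Ax NBx]].
(* Points are classes, so representatives are chosen before divisibility is compared. *)
apply/asboolP => y; rewrite -[y]reprK => By.
move: Ax NBx; rewrite -[x]reprK => Ax NBx.
have [xy|yx] := dvdM (repr x) (repr y); last exact: open_dvd yx Ax.
by case: NBx; apply: open_dvd xy By.
Qed.

End Modules.

Theorem theorem1 (R : idomainType) (M : lmodType R)
  (M_neq0 : nonzero_module M) (M_nsimple : ~ simple_module M) :
  uniserial M <-> nested (divisor_space M).
Proof. by rewrite uniserialP nestedP dvd_total_sharp. Qed.
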